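(* Let $\mathbf{B}$ be the $v\times v$ adjacency matrix of an $\operatorname{SRG}(v,k,\lambda,\mu)$ with $\mu=\frac{k}{2}$, and let $n=v+1$. Then $$m=\frac{v+1}{2}\left\{1+\frac{v-2k-1}{\left[(v-2k-1)^2+4v\right]^{1/2}}\right\}$$ is the unique choice of $m$ for which there exists a real number $\beta>0$ such that the $n\times n$ matrix $$\mathbf{G}=\begin{bmatrix}1&\beta\mathbf{1}^*\\ \beta\mathbf{1}&2\beta\mathbf{B}+(\beta+1)\mathbf{I}-\beta\mathbf{J}\end{bmatrix}$$ is the Gram matrix of a real equiangular tight frame for $\mathbb{R}^m$ consisting of $n=v+1$ vectors. (In particular, this number $m$ is a positive integer.) Moreover, for this $m$, any such $\beta$ is necessarily equal to $\left[\frac{n-m}{m(n-1)}\right]^{1/2}$.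
   Context: An adjacency matrix of a graph on $v\geq 1$ vertices is a $v\times v$ real symmetric matrix with all entries in $\{0,1\}$ and all diagonal entries equal to $0$. For nonnegative integers $k,\lambda,\mu$, a graph on $v$ vertices with adjacency matrix $\mathbf{B}$ is strongly regular with parameters $(v,k,\lambda,\mu)$, written $\operatorname{SRG}(v,k,\lambda,\mu)$, if $\mathbf{B}^2=(\lambda-\mu)\mathbf{B}+(k-\mu)\mathbf{I}+\mu\mathbf{J}$. Equivalently, every vertex has exactly $k$ neighbors, any two distinct adjacent vertices have exactly $\lambda$ common neighbors, and any two distinct nonadjacent vertices have exactly $\mu$ common neighbors. The cases $\mathbf{B}=\mathbf{0}$ and $\mathbf{B}=\mathbf{J}-\mathbf{I}$ are allowed. Here $\mathbf{I}$ is the $v\times v$ identity matrix, $\mathbf{1}$ is the $v\times 1$ all-ones vector, and $\mathbf{J}=\mathbf{1}\mathbf{1}^*$ is the $v\times v$ all-ones matrix. Let $m\leq n$ be positive integers. For vectors $\varphi_1,\dots,\varphi_n$ in $\mathbb{R}^m$, let $\mathbf{\Phi}$ be the $m\times n$ matrix whose $i$th column is $\varphi_i$. The Gram matrix of $\{\varphi_i\}_{i=1}^n$ is the $n\times n$ matrix $\mathbf{\Phi}^*\mathbf{\Phi}$, whose $(i,j)$ entry is $\langle\varphi_i,\varphi_j\rangle$. The vectors form a (real) equiangular tight frame (ETF) for $\mathbb{R}^m$ if (1) they form a tight frame, i.e. $\mathbf{\Phi}\mathbf{\Phi}^*=\alpha\mathbf{I}$ for some real $\alpha>0$, and (2) they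 are equiangular, i.e. every $\varphi_i$ has unit norm and $|\langle\varphi_i,\varphi_j\rangle|$ is constant over all $i\neq j$. *)

(* Defs.v *)
From HB Require Import structures.
From mathcomp Require Import all_boot all_order all_algebra.
From mathcomp Require Import reals.

Set Implicit Arguments.
Unset Strict Implicit.
Unset Printing Implicit Defensive.

Import Order.TTheory GRing.Theory Num.Theory.
Local Open Scope ring_scope.

Definition all_ones_mx (R : realType) (p q : nat) : 'M[R]_(p, q) := const_mx 1.
Arguments all_ones_mx {R p q}.

Definition adjacency_mx (R : realType) (v : nat) (B : 'M[R]_v) : Prop :=
  [/\ B^T = B,
      forall i j, B i j = 0 \/ B i j = 1
    & forall i, B i i = 0].

Definition is_srg (R : realType) (v k lambda mu : nat) (B : 'M[R]_v) : Prop :=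
  adjacency_mx B /\
  B *m B = (lambda%:R - mu%:R) *: B + (k%:R - mu%:R)%:M
           + mu%:R *: all_ones_mx.

Definition inner (R : realType) (m : nat) (x y : 'cV[R]_m) : R :=
  \sum_(i < m) x i 0 * y i 0.

(* The Euclidean norm; the library's norm on matrices is the sup norm. *)
Definition norm2 (R : realType) (m : nat) (x : 'cV[R]_m) : R :=
  Num.sqrt (inner x x).

Definition frame_mx (R : realType) (m n : nat) (phi : 'I_n -> 'cV[R]_m) :
    'M[R]_(m, n) :=
  \matrix_(i, j) phi j i 0.

Definition gram_mx (R : realType) (m n : nat) (phi : 'I_n -> 'cV[R]_m) :
    'M[R]_n :=
  (frame_mx phi)^T *m frame_mx phi.

Definition tight_frame (R : realType) (m n : nat) (phi : 'I_n -> 'cV[R]_m) :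
    Prop :=
  exists2 alpha : R, 0 < alpha & frame_mx phi *m (frame_mx phi)^T = alpha%:M.

Definition equiangular (R : realType) (m n : nat) (phi : 'I_n -> 'cV[R]_m) :
    Prop :=
  (forall i, norm2 (phi i) = 1) /\
  exists c : R, forall i j, i != j -> `|inner (phi i) (phi j)| = c.

Definition is_etf (R : realType) (m n : nat) (phi : 'I_n -> 'cV[R]_m) : Prop :=
  tight_frame phi /\ equiangular phi.

Definition is_etf_gram (R : realType) (m n : nat) (G : 'M[R]_n) : Prop :=
  exists2 phi : 'I_n -> 'cV[R]_m, is_etf phi & gram_mx phi = G.
Arguments is_etf_gram {R} m {n} G.

Definition srg_gram_mx (R : realType) (v : nat) (beta : R) (B : 'M[R]_v) :
    'M[R]_v.+1 :=
  block_mx (1%:M : 'M_1) (beta *: all_ones_mx)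
           (beta *: all_ones_mx)
           ((2 * beta) *: B + (beta + 1)%:M - beta *: all_ones_mx).

(* Main.v *)
(** Write G = I + βQ, where Q is the Seidel-type matrix bordered by a row and a
    column of ones. With δ = v - 2k - 1, the strong regularity of B and μ = k/2
    give Q² = vI - δQ. If G is the Gram matrix of an equiangular tight frame
    with constant α, then G² = αG and αm = tr G = n; comparing coefficients
    yields α = 1 + vβ² = 2 - δβ, which determines β > 0, hence α and m.
    Conversely, for the positive root β of vβ² + δβ = 1 the matrix G/α is a
    symmetric idempotent; splitting off unit vectors in its range one at a time
    writes it as Φᵀ Φ with Φ Φᵀ = I, and √α Φ is the required frame. *)
Require Import Defs.
From HB Require Import structures.
From mathcomp Require Import all_boot all_order all_algebra.
From mathcomp Require Import ring lra.
From mathcomp Require Import reals.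

Set Implicit Arguments.
Unset Strict Implicit.
Unset Printing Implicit Defensive.

Import Order.TTheory GRing.Theory Num.Theory.
Local Open Scope ring_scope.

(** * Real symmetric idempotents and their factorization *)

Lemma sym_idem_diag (R : realType) (n : nat) (P : 'M[R]_n) :
  P^T = P -> P *m P = P -> forall i, P i i = \sum_j P i j ^+ 2.
Proof.
move=> symP idP i; rewrite -{1}idP mxE; apply: eq_bigr => j _.
by rewrite -{2}symP mxE expr2.
Qed.

Lemma sym_idem_diag_ge0 (R : realType) (n : nat) (P : 'M[R]_n) :
  P^T = P -> P *m P = P -> forall i, 0 <= P i i.
Proof.
by move=> symP idP i; rewrite sym_idem_diag// sumr_ge0// => j _; rewrite sqr_ge0.
Qed.

Lemma sym_idem_diag_eq0 (R : realType) (n : nat) (P : 'M[R]_n) :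
  P^T = P -> P *m P = P -> (forall i, P i i = 0) -> P = 0.
Proof.
move=> symP idP P0; apply/matrixP => i j; rewrite mxE.
have : \sum_j P i j ^+ 2 = 0 by rewrite -sym_idem_diag.
move=> /psumr_eq0P/(_ j isT) => /(_ (fun l _ => sqr_ge0 (P i l)))/eqP.
by rewrite sqrf_eq0 => /eqP.
Qed.

(** Idempotence makes [P] fix each of its columns, and column [i] has squared length [P i i]; some
    diagonal entry is nonzero, so that column can be normalized. *)
Lemma sym_idem_unit_vector (R : realType) (n : nat) (P : 'M[R]_n) :
  P^T = P -> P *m P = P -> P != 0 ->
  exists2 u : 'cV[R]_n, P *m u = u & u^T *m u = 1%:M.
Proof.
move=> symP idP Pn0.
have [/existsP[i Pii]|/existsPn P0] := boolP [exists i, P i i != 0]; last first.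
  case/eqP: Pn0; apply: sym_idem_diag_eq0 => // i.
  by have := P0 i; rewrite negbK => /eqP.
have Pge := sym_idem_diag_ge0 symP idP i.
pose s := Num.sqrt (P i i).
have s0 : s != 0 by rewrite sqrtr_eq0 -ltNge lt_def Pii Pge.
exists (s^-1 *: col i P).
  by rewrite -scalemxAr colE mulmxA idP.
apply/matrixP => a b; rewrite !ord1 [(_ *: _)^T]linearZ /= -scalemxAl -scalemxAr scalerA.
rewrite !mxE /= (eq_bigr (fun j => P i j ^+ 2)); last first.
  by move=> j _; rewrite !mxE -{1 2}symP !mxE expr2.
rewrite -sym_idem_diag// -(sqr_sqrtr Pge) -/s.
by field.
Qed.

(** Subtracting [u *m u^T] for a unit vector [u] fixed by [P] leaves a symmetric idempotent with
    trace lowered by one. *)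
Lemma sym_idem_factor (R : realType) (n : nat) (P : 'M[R]_n) :
  P^T = P -> P *m P = P ->
  exists r, exists2 F : 'M[R]_(r, n), F^T *m F = P & F *m F^T = 1%:M.
Proof.
(* The trace is only known to be real, so the induction runs on a strict natural upper bound; the
   bound 0 contradicts the nonnegative diagonal. *)
have [N] : exists N : nat, \tr P < N%:R.
  by exists (Num.bound `|\tr P|); rewrite (le_lt_trans (ler_norm _))// archi_boundP.
elim: N P => [|N IHN] P trP symP idP.
  exfalso; move: trP; rewrite ltNge => /negP; apply.
  by apply: sumr_ge0 => i _; exact: sym_idem_diag_ge0.
have [->|Pn0] := eqVneq P 0.
  exists 0, 0; first by rewrite mulmx0.
  by apply/matrixP => -[].
have [u Pu uu] := sym_idem_unit_vector symP idP Pn0.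
have uP : u^T *m P = u^T by rewrite -{1}symP -trmx_mul Pu.
pose P' := P - u *m u^T.
have P'u : P' *m u = 0 by rewrite mulmxBl Pu -mulmxA uu mulmx1 subrr.
have [||| r [F FF FFt]] := IHN P'.
- rewrite /P' linearB /= mxtrace_mulC uu mxtrace1.
  by move: trP; rewrite -natr1; lra.
- by rewrite /P' linearB /= trmx_mul trmxK symP.
- by rewrite {2}/P' mulmxBr mulmxA P'u mul0mx subr0 mulmxBl idP -mulmxA uP.
(* [F] equals [F *m P'], which kills [u]; hence stacking [u^T] on [F] keeps the rows orthonormal. *)
have Fu : F *m u = 0.
  by rewrite -[F]mul1mx -FFt -!mulmxA [F^T *m _]mulmxA FF P'u mulmx0.
exists (1 + r)%N, (col_mx u^T F).
  by rewrite tr_col_mx trmxK mul_row_col FF addrC subrK.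
rewrite tr_col_mx trmxK mul_col_row uu FFt Fu -trmx_mul Fu trmx0.
by rewrite -scalar_mx_block.
Qed.

(** * Gram matrices of equiangular tight frames *)

Lemma gram_mxE (R : realType) (m n : nat) (phi : 'I_n -> 'cV[R]_m) i j :
  gram_mx phi i j = inner (phi i) (phi j).
Proof. by rewrite mxE; apply: eq_bigr => a _; rewrite !mxE. Qed.

Lemma etf_gram_sqr (R : realType) (m n : nat) (G : 'M[R]_n) :
  is_etf_gram m G ->
  exists2 alpha : R, m%:R * alpha = \tr G & G *m G = alpha *: G.
Proof.
case=> phi [[alpha _ tight] _] <-; exists alpha.
  by rewrite mxtrace_mulC tight mxtrace_scalar mulr_natl.
by rewrite /gram_mx -mulmxA [_ *m (_^T *m _)]mulmxA tight mul_scalar_mx scalemxAr.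
Qed.

(** The factor of the idempotent [alpha^-1 *: G], rescaled by the square root of [alpha], is the
    frame. The dimension stays existential here; the trace identity determines it later. *)
Lemma etf_gram_of_sqr (R : realType) (n : nat) (G : 'M[R]_n) (alpha b : R) :
  0 < alpha -> G^T = G -> G *m G = alpha *: G ->
  (forall i, G i i = 1) -> (forall i j, i != j -> `|G i j| = b) ->
  exists m : nat, is_etf_gram m G.
Proof.
move=> a0 symG sqrG diagG offG.
have an0 : alpha != 0 by rewrite gt_eqF.
have [||r [F FF FFt]] := @sym_idem_factor _ _ (alpha^-1 *: G).
- by rewrite linearZ /= symG.
- by rewrite -scalemxAl -scalemxAr sqrG [_ *: (alpha *: _)]scalerA mulVf// scale1r.
pose s := Num.sqrt alpha.
have ss : s * s = alpha by rewrite -expr2 sqr_sqrtr// ltW.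
pose phi j := col j (s *: F).
have frameE : frame_mx phi = s *: F by apply/matrixP => i j; rewrite !mxE.
have gramE : gram_mx phi = G.
  rewrite /gram_mx frameE [(_ *: _)^T]linearZ /= -scalemxAl -scalemxAr scalerA ss FF.
  by rewrite scalerA mulfV// scale1r.
exists r, phi => //; split; last split.
- exists alpha => //.
  by rewrite frameE [(_ *: _)^T]linearZ /= -scalemxAl -scalemxAr scalerA ss FFt scalemx1.
- by move=> i; rewrite /norm2 -gram_mxE gramE diagG sqrtr1.
- by exists b => i j ij; rewrite -gram_mxE gramE offG.
Qed.

(** * The bordered Seidel-type matrix *)

(** This is the Q of the overview. The identity cancels the diagonal of [- all_ones_mx]; off the
    diagonal, adjacency gives 1 and nonadjacency -1. *)
Definition signature_mx (R : realType) (v : nat) (B : 'M[R]_v) : 'M[R]_(1 + v) :=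
  block_mx 0 all_ones_mx all_ones_mx (2 *: B + 1%:M - all_ones_mx).

Lemma srg_gram_mxE (R : realType) (v : nat) (beta : R) (B : 'M[R]_v) :
  srg_gram_mx beta B = 1%:M + beta *: signature_mx B.
Proof.
have dr_block : (2 * beta) *: B + (beta + 1)%:M - beta *: all_ones_mx =
    1%:M + beta *: (2 *: B + 1%:M - all_ones_mx).
  by apply/matrixP => i j; rewrite !mxE; case: (i == j);
    rewrite /= ?mulr1n ?mulr0n; ring.
rewrite /srg_gram_mx /signature_mx (scalar_mx_block 1 v) scale_block_mx.
by rewrite add_block_mx scaler0 addr0 !add0r dr_block.
Qed.

Lemma signature_mx_diag (R : realType) (v : nat) (B : 'M[R]_v) :
  adjacency_mx B -> forall i, signature_mx B i i = 0.
Proof.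
case=> _ _ B0 i; rewrite /signature_mx.
case: (split_ordP i) => j ->; first by rewrite block_mxEul mxE.
by rewrite block_mxEdr !mxE B0 eqxx mulr1n mulr0 add0r subrr.
Qed.

Lemma signature_mx_offdiag (R : realType) (v : nat) (B : 'M[R]_v) :
  adjacency_mx B -> forall i j, i != j -> `|signature_mx B i j| = 1.
Proof.
case=> _ B01 _ i j; rewrite /signature_mx.
case: (split_ordP i) => i' ->; case: (split_ordP j) => j' -> ij.
- by move: ij; rewrite !ord1 eqxx.
- by rewrite block_mxEur mxE normr1.
- by rewrite block_mxEdl mxE normr1.
- rewrite block_mxEdr !mxE.
  have -> : (i' == j') = false by apply: contraNF ij => /eqP ->.
  rewrite mulr0n addr0; have [->|->] := B01 i' j'.
    by rewrite mulr0 add0r normrN1.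
  by rewrite (_ : 2 * 1 - 1 = 1) ?normr1//; ring.
Qed.

Lemma signature_mx_tr (R : realType) (v : nat) (B : 'M[R]_v) :
  B^T = B -> (signature_mx B)^T = signature_mx B.
Proof.
move=> symB; rewrite /signature_mx tr_block_mx !linearB !linearD /= linearZ /=.
by rewrite symB trmx0 trmx1 /all_ones_mx !trmx_const.
Qed.

(** * Strongly regular graphs with μ = k/2 *)

Lemma all_ones_mxM (R : realType) (p q r : nat) :
  (all_ones_mx : 'M[R]_(p, q)) *m (all_ones_mx : 'M[R]_(q, r)) =
  q%:R *: all_ones_mx.
Proof.
apply/matrixP => i j; rewrite !mxE mulr1 (eq_bigr (fun=> 1)).
  by rewrite sumr_const card_ord.
by move=> l _; rewrite !mxE mulr1.
Qed.

Section StronglyRegular.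
Variables (R : realType) (v k lambda mu : nat) (B : 'M[R]_v).
Hypothesis srgB : is_srg k lambda mu B.
Let delta : R := v%:R - 2 * k%:R - 1.

(** Entries 0 and 1 equal their squares, so a row sum of [B] is a diagonal entry of [B *m B]. *)
Lemma srg_regular (i : 'I_v) : \sum_j B i j = k%:R.
Proof.
have [[symB B01 B0] /matrixP/(_ i i)] := srgB.
rewrite !mxE B0 eqxx mulr1n !mulr1 mulr0 add0r subrK => <-.
apply: eq_bigr => j _; rewrite -{3}symB mxE.
by have [->|->] := B01 i j; rewrite ?mulr0 ?mulr1.
Qed.

Lemma srg_mul_ones (p : nat) :
  B *m (all_ones_mx : 'M_(v, p)) = k%:R *: all_ones_mx.
Proof.
apply/matrixP => i j; rewrite !mxE mulr1 -(srg_regular i).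
by apply: eq_bigr => l _; rewrite mxE mulr1.
Qed.

Lemma ones_mul_srg (p : nat) :
  (all_ones_mx : 'M_(p, v)) *m B = k%:R *: all_ones_mx.
Proof.
have [[symB _ _] _] := srgB.
have := congr1 trmx (srg_mul_ones p).
by rewrite trmx_mul symB linearZ /= /all_ones_mx !trmx_const.
Qed.

(** Both sides of the defining equation are applied to the all-ones vector, an eigenvector of [B]
    with eigenvalue [k]. *)
Lemma srg_count :
  (0 < v)%N ->
  k%:R ^+ 2 = (lambda%:R - mu%:R) * k%:R + (k%:R - mu%:R) + mu%:R * v%:R :> R.
Proof.
move=> v0; have [_ sqrB] := srgB; pose i : 'I_v := Ordinal v0.
have := congr1 (fun M => (M *m (all_ones_mx : 'cV_v)) i 0) sqrB.
rewrite -mulmxA srg_mul_ones -scalemxAr srg_mul_ones !mulmxDl -!scalemxAl.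
rewrite srg_mul_ones all_ones_mxM mul_scalar_mx !mxE !mulr1.
by move=> <-; rewrite expr2.
Qed.

(* The edgeless graph leaves lambda free, whence the factor [B i j]. *)
Lemma srg_half_lambda (i j : 'I_v) :
  mu%:R = k%:R / 2 :> R ->
  (2 * (lambda%:R - mu%:R) + delta + 2) * B i j = 0.
Proof.
move=> muk; have [[_ B01 _] _] := srgB.
have /srg_count E : (0 < v)%N by case: (v) i => // -[].
have [k0|kn0] := eqVneq (k%:R : R) 0.
  have /psumr_eq0P/(_ j isT) -> // : \sum_j B i j = 0 by rewrite srg_regular.
    by rewrite mulr0.
  by move=> l _; have [->|->] := B01 i l.
suff -> : 2 * (lambda%:R - mu%:R) + delta + 2 = 0 :> R by rewrite mul0r.
(* Multiplied by [k], the claim is [srg_count] at μ = k/2, up to a factor 2. *)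
apply: (mulfI kn0); rewrite mulr0 /delta.
by move: E; rewrite muk; lra.
Qed.

Lemma signature_mx_sqr :
  mu%:R = k%:R / 2 :> R ->
  signature_mx B *m signature_mx B = v%:R%:M - delta *: signature_mx B.
Proof.
move=> muk; have [_ sqrB] := srgB.
rewrite /signature_mx mulmx_block !mul0mx !mulmx0 !all_ones_mxM.
rewrite (scalar_mx_block 1 v) scale_block_mx opp_block_mx add_block_mx.
congr (block_mx _ _ _ _).
- by apply/matrixP => i j; rewrite !mxE !ord1 eqxx mulr1n; ring.
- rewrite mulmxBr mulmxDr -scalemxAr ones_mul_srg mulmx1 all_ones_mxM.
  by apply/matrixP => i j; rewrite !mxE /delta; ring.
- rewrite mulmxBl mulmxDl -scalemxAl srg_mul_ones mul1mx all_ones_mxM.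
  by apply/matrixP => i j; rewrite !mxE /delta; ring.
(* In this block the coefficients of I and J agree outright, while those of [B] differ by twice the
   factor in [srg_half_lambda]. *)
- rewrite !(mulmxBl, mulmxDl, mulmxBr, mulmxDr) -!scalemxAl -!scalemxAr.
  rewrite !mul1mx !mulmx1 sqrB srg_mul_ones ones_mul_srg all_ones_mxM.
  apply/matrixP => i j; have := srg_half_lambda i j muk.
  rewrite !mxE !mulr1; case: (i == j); rewrite ?mulr1n ?mulr0n /delta muk; lra.
Qed.

End StronglyRegular.

(** Two entries of G² = αG suffice: the border diagonal gives α = 1 + vβ², and a border entry off
    the diagonal gives α = 2 - δβ after division by β. *)
Lemma srg_etf_gram_params (R : realType) (v k lambda mu m : nat) (B : 'M[R]_v)
    (beta : R) :
  (0 < v)%N -> is_srg k lambda mu B -> mu%:R = k%:R / 2 :> R ->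
  0 < beta -> is_etf_gram m (srg_gram_mx beta B) ->
  m%:R * (1 + v%:R * beta ^+ 2) = v.+1%:R :> R /\
  v%:R * beta ^+ 2 + (v%:R - 2 * k%:R - 1) * beta = 1.
Proof.
move=> v0 srgB muk b0 /etf_gram_sqr[alpha trG].
have adjB : adjacency_mx B by case: srgB.
pose i : 'I_(1 + v) := lshift v ord0.
pose j : 'I_(1 + v) := rshift 1 (Ordinal v0).
have Qii : signature_mx B i i = 0 by exact: signature_mx_diag.
have Qij : signature_mx B i j = 1 by rewrite /signature_mx block_mxEur mxE.
rewrite srg_gram_mxE mulmxDl mul1mx mulmxDr mulmx1 -scalemxAl -scalemxAr.
rewrite (signature_mx_sqr srgB muk).
move: (signature_mx B) Qii Qij => Q Qii Qij sqrG.
have := congr1 (fun M : 'M_(1 + v) => M i i) sqrG.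
have := congr1 (fun M : 'M_(1 + v) => M i j) sqrG.
rewrite !mxE Qii Qij eqxx (_ : (i == j) = false)// !mulr0n !mulr1n.
move=> Eij Eii.
have alphaE : alpha = 1 + v%:R * beta ^+ 2 by move: Eii; lra.
split.
  rewrite -alphaE trG srg_gram_mxE linearD linearZ /= mxtrace1.
  rewrite /mxtrace big1 ?mulr0 ?addr0// => l _; exact: signature_mx_diag.
apply: (mulfI (lt0r_neq0 b0)); move: Eij; rewrite alphaE; lra.
Qed.

(** * The quadratic equation for β *)

Lemma root_linear_coef (R : realType) (v delta beta : R) :
  0 < beta -> v * beta ^+ 2 + delta * beta = 1 ->
  delta = (1 - v * beta ^+ 2) / beta.
Proof. by move=> b0 <-; field; rewrite gt_eqF. Qed.

(** Eliminating [delta] turns the discriminant into a perfect square, which removes the radical from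
    the formula for m. *)
Lemma pos_root_discriminant (R : realType) (v delta beta : R) :
  0 <= v -> 0 < beta -> v * beta ^+ 2 + delta * beta = 1 ->
  Num.sqrt (delta ^+ 2 + 4 * v) = (1 + v * beta ^+ 2) / beta.
Proof.
move=> v0 b0 E.
have bn0 : beta != 0 by rewrite gt_eqF.
have dE := root_linear_coef b0 E.
have -> : delta ^+ 2 + 4 * v = ((1 + v * beta ^+ 2) / beta) ^+ 2.
  by rewrite dE; field.
rewrite sqrtr_sqr ger0_norm// divr_ge0 ?(ltW b0)// addr_ge0//.
by rewrite mulr_ge0// sqr_ge0.
Qed.

Lemma pos_root_exists (R : realType) (v delta : R) :
  0 < v -> exists2 beta : R, 0 < beta & v * beta ^+ 2 + delta * beta = 1.
Proof.
move=> v0; pose D := Num.sqrt (delta ^+ 2 + 4 * v).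
have D0 : 0 < delta ^+ 2 + 4 * v by rewrite ltr_wpDl ?sqr_ge0// mulr_gt0.
have DD : D ^+ 2 = delta ^+ 2 + 4 * v by rewrite sqr_sqrtr// ltW.
have dD : delta < D.
  rewrite (le_lt_trans (ler_norm _))// -sqrtr_sqr ltr_sqrt// ltrDl.
  by rewrite mulr_gt0.
have vn0 : v != 0 by rewrite gt_eqF.
(* The larger root from the quadratic formula, positive since [delta < D]. *)
exists ((D - delta) / (2 * v)).
  by rewrite divr_gt0 ?subr_gt0// mulr_gt0.
have -> : v * ((D - delta) / (2 * v)) ^+ 2 + delta * ((D - delta) / (2 * v)) =
          (D ^+ 2 - delta ^+ 2) / (4 * v) by field.
by rewrite DD; field.
Qed.

Lemma srg_etf_gram_exists (R : realType) (v k lambda mu : nat) (B : 'M[R]_v)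
    (beta : R) :
  is_srg k lambda mu B -> mu%:R = k%:R / 2 :> R ->
  0 < beta -> v%:R * beta ^+ 2 + (v%:R - 2 * k%:R - 1) * beta = 1 ->
  exists m : nat, is_etf_gram m (srg_gram_mx beta B).
Proof.
move=> srgB muk b0 E; have [adjB _] := srgB; have [symB _ _] := adjB.
rewrite srg_gram_mxE.
have symQ := signature_mx_tr symB.
have sqrQ := signature_mx_sqr srgB muk.
have diagQ := signature_mx_diag adjB.
have offQ := signature_mx_offdiag adjB.
move: (signature_mx B) symQ sqrQ diagQ offQ => Q symQ sqrQ diagQ offQ.
apply: (@etf_gram_of_sqr _ _ _ (1 + v%:R * beta ^+ 2) beta).
- by rewrite ltr_pwDl// mulr_ge0// sqr_ge0.
- by rewrite linearD linearZ /= symQ trmx1.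
(* G² = (1 + vβ²)I + β(2 - δβ)Q, and the equation for β makes both bracketed factors equal. *)
- rewrite mulmxDl mul1mx mulmxDr mulmx1 -scalemxAl -scalemxAr sqrQ.
  have dE := root_linear_coef b0 E.
  apply/matrixP => i j; rewrite !mxE dE.
  by case: (i == j); rewrite ?mulr1n ?mulr0n; field; rewrite gt_eqF.
- by move=> i; rewrite !mxE diagQ eqxx mulr0 addr0.
- move=> i j ij; rewrite !mxE (negbTE ij) add0r normrM.
  by rewrite offQ// mulr1 gtr0_norm.
Qed.

Theorem theorem3p2 (R : realType) (v k lambda mu : nat) (B : 'M[R]_v)
    (v_gt0 : (0 < v)%N)
    (srgB : is_srg k lambda mu B)
    (mu_half : mu%:R = k%:R / 2 :> R) :
  exists m : nat,
    [/\ m%:R = (v%:R + 1) / 2 *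
               (1 + (v%:R - 2 * k%:R - 1)
                    / Num.sqrt ((v%:R - 2 * k%:R - 1) ^+ 2 + 4 * v%:R)) :> R,
        unique (fun m' : nat => (0 < m' <= v.+1)%N /\
                  exists2 beta : R, 0 < beta
                                  & is_etf_gram m' (srg_gram_mx beta B)) m
      & forall beta : R, 0 < beta -> is_etf_gram m (srg_gram_mx beta B) ->
          beta = Num.sqrt ((v.+1%:R - m%:R) / (m%:R * (v.+1%:R - 1)))].
Proof.
have vp : 0 < v%:R :> R by rewrite ltr0n.
set delta : R := v%:R - 2 * k%:R - 1.
have alpha_gt0 (beta : R) : 0 < 1 + v%:R * beta ^+ 2.
  by rewrite ltr_pwDl// mulr_ge0// sqr_ge0.
(* The right-hand side is free of [beta], so this yields both the closed form and the uniqueness of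
   the dimension. *)
have dimE m beta : 0 < beta -> is_etf_gram m (srg_gram_mx beta B) ->
    m%:R = (v%:R + 1) / 2 * (1 + delta / Num.sqrt (delta ^+ 2 + 4 * v%:R)).
  move=> b0 etfm.
  have [mE E] := srg_etf_gram_params v_gt0 srgB mu_half b0 etfm.
  rewrite (pos_root_discriminant (ltW vp) b0 E).
  have an0 := lt0r_neq0 (alpha_gt0 beta); apply: (mulIf an0).
  rewrite mE -natr1 /delta (root_linear_coef b0 E).
  by field; rewrite an0 gt_eqF.
have [beta b0 E] := pos_root_exists delta vp.
have [m etfm] := srg_etf_gram_exists srgB mu_half b0 E.
exists m; split; first exact: dimE etfm.
- split; last first.
    move=> m' [_ [beta' b'0 etfm']]; apply/eqP; rewrite -(eqr_nat R).
    by rewrite (dimE _ _ b0 etfm) (dimE _ _ b'0 etfm').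
  split; last by exists beta.
  have [mE _] := srg_etf_gram_params v_gt0 srgB mu_half b0 etfm.
  (* Both bounds come from m(1 + vβ²) = v + 1, whose second factor is at least 1. *)
  apply/andP; split.
    by rewrite -(ltr0n R) -(pmulr_lgt0 _ (alpha_gt0 beta)) mE ltr0n.
  by rewrite -(ler_nat R) -mE ler_peMr// lerDl mulr_ge0// sqr_ge0.
- move=> beta' b'0 etfm'.
  have [mE _] := srg_etf_gram_params v_gt0 srgB mu_half b'0 etfm'.
  have mn0 : m%:R != 0 :> R.
    by apply: contra_eq_neq mE => ->; rewrite mul0r eq_sym pnatr_eq0.
  (* As [beta'] is positive, it suffices to compare squares: the dimension identity reads n - m =
     mvβ², with n - 1 = v. *)
  rewrite -[LHS]ger0_norm ?ltW// -sqrtr_sqr; congr Num.sqrt.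
  rewrite -natr1 addrK; rewrite -natr1 in mE.
  by rewrite -mE; field; rewrite mn0 (lt0r_neq0 vp).
Qed.
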